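(* Let $n$ be a positive integer and $0\le\alpha\le1$, and let $A_n^\alpha$ be the $n\times n$ matrix with ones on the diagonal and all off-diagonal entries equal to $\alpha$. Then $\mathrm{rank}_\theta^{\mathrm{psd}}(A_n^\alpha)$ is the smallest dimension $d$ for which there exists an equiangular set of $n$ lines in $\mathbb{C}^d$ with common angle $\arccos\alpha$.
   Context: For a symmetric matrix $A\in\mathbb{R}^{n\times n}$ with nonnegative entries, its psd-phaseless rank is $\mathrm{rank}_\theta^{\mathrm{psd}}(A)=\min\{\mathrm{rank}(B) : B\in\mathbb{C}^{n\times n},\ |B_{ij}|=A_{ij}\text{ for all }i,j,\ B\succeq0\}$, where $B\succeq 0$ means that $B$ is Hermitian positive semidefinite. An equiangular set of $n$ lines in $\mathbb{C}^d$ with common angle $\arccos\alpha$ means $n$ lines through the origin spanned by unit vectors $v_1,\dots,v_n\in\mathbb{C}^d$ with $|v_i^*v_j|=\alpha$ for all $i\ne j$ (lines are indexed by $1,\dots,n$; in the degenerate case $\alpha=1$ they coincide). *)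

(* Defs.v *)
From HB Require Import structures.
From mathcomp Require Import all_boot all_order all_algebra.
From mathcomp Require Import boolp classical_sets reals.
From mathcomp Require Import complex.

Set Implicit Arguments.
Unset Strict Implicit.
Unset Printing Implicit Defensive.

Import Order.TTheory GRing.Theory Num.Theory.

Local Open Scope classical_set_scope.
Local Open Scope ring_scope.
Local Open Scope complex_scope.
Local Open Scope sesquilinear_scope.

Definition is_least (S : set nat) (m : nat) : Prop :=
  S m /\ forall k, S k -> (m <= k)%N.

(* Junk value: least_nat set0 = 0. *)
Definition least_nat (S : set nat) : nat :=
  if pselect (exists k, `[< S k >]) is left exS then ex_minn exS else 0%N.

Lemma least_natP (S : set nat) : S !=set0 -> is_least S (least_nat S).
Proof.
move=> [k Sk]; rewrite /least_nat; case: pselect => [exS|[]]; last first.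
  by exists k; apply/asboolP.
case: ex_minnP => m /asboolP Sm m_min; split=> // j Sj.
by apply: m_min; apply/asboolP.
Qed.

(* The order of R[i] is partial: 0 <= z forces z to be real. *)
Definition psd (R : realType) n (B : 'M[R[i]]_n) : Prop :=
  B \is hermsymmx /\ forall x : 'cV[R[i]]_n, 0 <= (x^t* *m B *m x) 0 0.

(* The norm `|z| of z : R[i] is itself an element of R[i], hence the %:C. *)
Definition has_modulus (R : realType) n (A : 'M[R]_n) (B : 'M[R[i]]_n) : Prop :=
  forall i j, `|B i j| = (A i j)%:C.

(* Intended for A symmetric with nonnegative entries. The value is 0 if A is
   not the entrywise modulus of any positive semidefinite matrix. *)
Definition psd_phaseless_rank (R : realType) n (A : 'M[R]_n) : nat :=
  least_nat [set \rank B | B in [set B | has_modulus A B /\ psd B]].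

Definition equiangular_mx (R : realType) n (alpha : R) : 'M[R]_n :=
  \matrix_(i, j) if i == j then 1 else alpha.

(* A family of lines indexed by 'I_n: the lines may coincide, which happens
   exactly when alpha = 1 and n > 1. *)
Definition equiangular_lines (R : realType) n d (alpha : R)
    (L : 'I_n -> {vspace 'cV[R[i]]_d}) : Prop :=
  exists v : 'I_n -> 'cV[R[i]]_d,
    [/\ forall i, L i = <[v i]>%VS,
        forall i, ((v i)^t* *m v i) 0 0 = 1
      & forall i j, i != j -> `|((v i)^t* *m v j) 0 0| = alpha%:C].

(* Main.v *)
Require Import Defs.
From mathcomp Require Import all_boot all_order all_algebra.
From mathcomp Require Import boolp classical_sets reals.
From mathcomp Require Import complex.

(** The two minimization problems are the same problem, read through Gram
    matrices.  Collect vectors [v_1, ..., v_n] of [C^d] as the columns of a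
    [d x n] matrix [W]; the numbers [v_i^* v_j] are the entries of [W^* W].
    Hence the [v_i] are unit vectors spanning equiangular lines with angle
    [arccos alpha] exactly when [W^* W] has entrywise modulus [A_n^alpha]; a
    diagonal entry of [W^* W] of modulus 1 equals 1 because it is nonnegative
    ([equiangular_gramP]).

    Matrices of the form [W^* W] are positive semidefinite of rank at most [d]
    ([psd_gram], [mxrank_gram]).  Conversely a positive semidefinite [B] is
    [W^* W] for some [W] with exactly [rank B] rows ([psd_gram_factor]): the
    spectral theorem gives a square root of [B] up to a unitary, and
    orthonormal coordinates in its row space cut the number of rows down to
    the rank.  So a psd [B] of minimal rank yields lines in dimension [rank B],
    and lines in dimension [d] yield a psd matrix of rank at most [d].

    It remains to see that the minimum is taken over a nonempty set:
    [(1 - alpha) I + alpha J] is the Gram matrix of [n] vectors in dimension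
    [1 + n] ([equiangular_gram_exists]), because [0 <= alpha <= 1]. *)

Set Implicit Arguments.
Unset Strict Implicit.
Unset Printing Implicit Defensive.

Import Order.TTheory GRing.Theory Num.Theory.

Local Open Scope classical_set_scope.
Local Open Scope ring_scope.
Local Open Scope complex_scope.
Local Open Scope sesquilinear_scope.

Section Gram.
Variable C : numClosedFieldType.

Lemma trmxC_mul m n p (A : 'M[C]_(m, n)) (B : 'M[C]_(n, p)) :
  (A *m B)^t* = B^t* *m A^t*.
Proof. by rewrite trmx_mul map_mxM. Qed.

Lemma gram_ge0 d (u : 'cV[C]_d) : 0 <= (u^t* *m u) 0 0.
Proof.
rewrite mxE sumr_ge0 // => k _.
by rewrite !mxE mulrC mul_conjC_ge0.
Qed.

Lemma congr_mxE d n (B : 'M[C]_d) (W : 'M[C]_(d, n)) i j :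
  (W^t* *m B *m W) i j = ((col i W)^t* *m B *m col j W) 0 0.
Proof.
rewrite !mxE; apply: eq_bigr => k _; rewrite !mxE; congr (_ * _).
by apply: eq_bigr => l _; rewrite !mxE.
Qed.

Lemma gramE d n (W : 'M[C]_(d, n)) i j :
  (W^t* *m W) i j = ((col i W)^t* *m col j W) 0 0.
Proof. by have := congr_mxE 1%:M W i j; rewrite !mulmx1. Qed.

Lemma gram_hermsym d n (W : 'M[C]_(d, n)) : W^t* *m W \is hermsymmx.
Proof. by apply/is_hermitianmxP; rewrite expr0 scale1r trmxC_mul trmxCK. Qed.

Lemma mxrank_gram d n (W : 'M[C]_(d, n)) : (\rank (W^t* *m W) <= d)%N.
Proof. exact: leq_trans (mxrankM_maxr _ _) (rank_leq_row _). Qed.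

(** With [P] the unitary diagonalizing [B], the eigenvalues are the diagonal
    entries of [P B P^*], that is, the values of the quadratic form of [B] at
    the columns of [P^*]. *)
Lemma spectral_diag_ge0 n (B : 'M[C]_n) :
    B \is hermsymmx -> (forall x : 'cV[C]_n, 0 <= (x^t* *m B *m x) 0 0) ->
  forall i, 0 <= spectral_diag B 0 i.
Proof.
move=> Bherm Bge0 i; set P := spectralmx B.
have Pu : P \is unitarymx by exact: spectral_unitarymx.
have /hermitian_normalmx/orthomx_spectralP BE := Bherm.
suff -> : spectral_diag B 0 i = (P *m B *m P^t*) i i.
  by rewrite -{1}[P]trmxCK congr_mxE.
rewrite {2}BE -/P invmx_unitary // !mulmxA (unitarymxP Pu) mul1mx.
by rewrite mulmxtVK // mxE eqxx mulr1n.
Qed.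

(** Write [S = T Q] with the rows of [Q] an orthonormal basis of the row space
    of [S]; then [S S^* = T Q Q^* T^* = T T^*]. *)
Lemma gram_rank_factor m n (S : 'M[C]_(m, n)) :
  exists T : 'M[C]_(m, \rank S), S *m S^t* = T *m T^t*.
Proof.
pose Q := schmidt (row_base S).
have Qu : Q \is unitarymx by rewrite schmidt_unitarymx // rank_leq_col.
have /submxP[T ST] : (S <= Q)%MS.
  by rewrite -(eq_row_base S) schmidt_sub.
exists T; have -> : S *m S^t* = (T *m Q) *m (T *m Q)^t* by rewrite -ST.
by rewrite trmxC_mul mulmxA mulmxtVK.
Qed.

(** From [B = P^* D P] with [D >= 0] diagonal, [S = P^* sqrt(D)] satisfies
    [B = S S^*] and has the rank of [B], so that the number of columns of [S]
    can be cut down to this rank by [gram_rank_factor]. *)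
Lemma psd_gram_factor n (B : 'M[C]_n) :
    B \is hermsymmx -> (forall x : 'cV[C]_n, 0 <= (x^t* *m B *m x) 0 0) ->
  exists W : 'M[C]_(\rank B, n), B = W^t* *m W.
Proof.
move=> Bherm Bge0; have dge0 := spectral_diag_ge0 Bherm Bge0.
set P := spectralmx B in dge0; set d := spectral_diag B in dge0.
have Pu : P \is unitarymx by exact: spectral_unitarymx.
have BE : B = P^t* *m diag_mx d *m P.
  have /hermitian_normalmx/orthomx_spectralP := Bherm.
  by rewrite -/P invmx_unitary.
pose e : 'rV[C]_n := \row_i sqrtC (d 0 i).
pose S := P^t* *m diag_mx e.
have BS : B = S *m S^t*.
  rewrite trmxC_mul trmxCK mulmxA BE -[_ *m diag_mx e *m _]mulmxA.
  congr (_ *m _ *m _); apply/matrixP=> i j; rewrite mul_diag_mx !mxE.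
  have [->|_] := eqVneq j i; last by rewrite !mulr0n conjC0 mulr0.
  rewrite !mulr1n (conj_Creal (ger0_real _)) ?sqrtC_ge0 //.
  by rewrite -expr2 sqrtCK.
(* [S = B P^* D^(-1/2)], where the convention [0^-1 = 0] makes [D^(-1/2)] the
   pseudo-inverse of [sqrt(D)]. *)
have SB : S = B *m (P^t* *m diag_mx (\row_i (e 0 i)^-1)).
  rewrite BE mulmxA mulmxtVK // -mulmxA; congr (_ *m _).
  apply/matrixP=> i j; rewrite mul_diag_mx !mxE.
  have [->|_] := eqVneq i j; last by rewrite !mulr0n mulr0.
  rewrite !mulr1n; have [dj0|dj_neq0] := eqVneq (d 0 j) 0.
    by rewrite dj0 sqrtC0 mul0r.
  by rewrite -{2}[d 0 j]sqrtCK expr2 mulfK ?sqrtC_eq0.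
have rkS : \rank S = \rank B.
  apply/eqP; rewrite eqn_leq {1}SB {3}BS.
  by rewrite !mxrankM_maxl.
rewrite -rkS; have [T ST] := gram_rank_factor S.
by exists (T^t*); rewrite trmxCK -ST.
Qed.

End Gram.

(** A diagonal entry of a Gram matrix is nonnegative, so modulus 1 forces it
    to be 1: this is what makes the modulus condition on the diagonal say that
    the vectors are unit. *)
Lemma equiangular_gramP (R : realType) n d (alpha : R) (W : 'M[R[i]]_(d, n)) :
  has_modulus (equiangular_mx n alpha) (W^t* *m W) <->
  (forall i, ((col i W)^t* *m col i W) 0 0 = 1) /\
  (forall i j, i != j -> `|((col i W)^t* *m col j W) 0 0| = alpha%:C).
Proof.
split=> [mod | [W1 Walpha] i j].
  split=> [i|i j ij]; last by rewrite -gramE mod mxE (negPf ij).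
  by rewrite -[LHS]ger0_norm ?gram_ge0 // -gramE mod mxE eqxx.
rewrite gramE [equiangular_mx _ _ _ _]mxE; have [->|/Walpha//] := eqVneq i j.
by rewrite W1 normr1.
Qed.

Lemma psd_gram (R : realType) d n (W : 'M[R[i]]_(d, n)) : psd (W^t* *m W).
Proof.
split=> [|x]; first exact: gram_hermsym.
by rewrite mulmxA -mulmxA -trmxC_mul gram_ge0.
Qed.

(** The vectors [sqrt alpha e_0 + sqrt (1 - alpha) e_i] have Gram matrix
    [(1 - alpha) I + alpha J]. *)
Lemma equiangular_gram_exists (R : realType) n (alpha : R) :
  0 <= alpha <= 1 ->
  exists W : 'M[R[i]]_(1 + n, n),
    has_modulus (equiangular_mx n alpha) (W^t* *m W).
Proof.
move=> /andP[alpha_ge0 alpha_le1].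
pose a : R[i] := sqrtC alpha%:C; pose b : R[i] := sqrtC (1 - alpha)%:C.
have a_ge0 : 0 <= a by rewrite sqrtC_ge0 ler0c.
have b_ge0 : 0 <= b by rewrite sqrtC_ge0 ler0c subr_ge0.
pose W : 'M[R[i]]_(1 + n, n) := col_mx (const_mx a) b%:M.
exists W => i j.
have -> : (W^t* *m W) i j = (equiangular_mx n alpha i j)%:C.
  rewrite tr_col_mx map_row_mx mul_row_col tr_scalar_mx map_scalar_mx.
  rewrite -scalar_mxM !mxE big_ord1 !mxE /=.
  rewrite !(conj_Creal (ger0_real _)) // -!expr2 !sqrtCK.
  have [_|_] := eqVneq i j; last by rewrite mulr0n addr0.
  by rewrite mulr1n -(rmorphD (real_complex R)) addrC subrK.
rewrite ger0_norm // ler0c mxE.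
by case: eqVneq.
Qed.

Theorem proposition6p12 (R : realType) (n : nat) (alpha : R) :
  (0 < n)%N -> 0 <= alpha <= 1 ->
  is_least
    [set d : nat | exists L : 'I_n -> {vspace 'cV[R[i]]_d},
                     equiangular_lines alpha L]
    (psd_phaseless_rank (equiangular_mx n alpha)).
Proof.
move=> _ alpha01; rewrite /psd_phaseless_rank.
set ranks := [set _ | _ in _].
have ranks_neq0 : ranks !=set0.
  have [W modW] := equiangular_gram_exists n alpha01.
  by exists (\rank (W^t* *m W)), (W^t* *m W) => //; split=> //; exact: psd_gram.
have [[B [modB [Bherm Bge0]] <-] rank_min] := least_natP ranks_neq0.
split=> [|d [L [v [_ v1 valpha]]]].
  have [W BW] := psd_gram_factor Bherm Bge0.
  rewrite BW in modB; have [W1 Walpha] := (equiangular_gramP _ _).1 modB.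
  by exists (fun i => <[col i W]>%VS), (fun i => col i W); split.
pose W : 'M[R[i]]_(d, n) := \matrix_(k, i) v i k 0.
have Wv i : col i W = v i by apply/colP=> k; rewrite !mxE.
apply: leq_trans (mxrank_gram W); apply: rank_min.
exists (W^t* *m W) => //; split; last exact: psd_gram.
apply/equiangular_gramP; split=> [i|i j ij]; first by rewrite Wv.
by rewrite !Wv; exact: valpha.
Qed.
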